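(* Let $G$ be a rectifiable space which is a charming space. Then the Suslin number of $G$ is countable, i.e. every pairwise disjoint family of non-empty open subsets of $G$ is countable.
   Context: All spaces are Tychonoff. A perfect map is a continuous closed map with compact fibres. A space $X$ is a Lindelöf $\Sigma$-space if there exists a space $Z$ which maps continuously onto $X$ and perfectly onto a second countable space. A space $X$ is charming if there is a subspace $Y\subset X$ that is a Lindelöf $\Sigma$-space and such that for each open set $U$ of $X$ with $Y\subset U$, the subspace $X\setminus U$ is a Lindelöf $\Sigma$-space. A space $G$ is rectifiable if there are a surjective homeomorphism $\varphi: G\times G\rightarrow G\times G$ and an element $e\in G$ such that $\pi_{1}\circ\varphi=\pi_{1}$ and $\varphi(x,x)=(x,e)$ for every $x\in G$, where $\pi_{1}: G\times G\rightarrow G$ is the projection to the first coordinate. *)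

(* Defs.v *)
From HB Require Import structures.
From mathcomp Require Import all_boot all_order all_algebra.
From mathcomp Require Import all_classical all_reals all_analysis.

Set Implicit Arguments.
Unset Strict Implicit.
Unset Printing Implicit Defensive.

Local Open Scope classical_set_scope.

(* T1 and completely regular.  [completely_regular_space] separates points from
   closed sets by a coarser uniformity; [uniform_separatorP] turns this into
   separation by a continuous function into the unit interval. *)
Definition tychonoff_space (T : topologicalType) : Prop :=
  accessible_space T /\ completely_regular_space T.

Definition perfect_map (Z M : topologicalType) (p : Z -> M) : Prop :=
  [/\ continuous p,
      forall C : set Z, closed C -> closed (p @` C)
    & forall y : M, compact (p @^-1` [set y])].

(* All spaces are assumed to be Tychonoff, including the auxiliary ones. *)
Definition lindelof_sigma (X : topologicalType) : Prop :=
  exists (Z M : topologicalType) (f : Z -> X) (p : Z -> M),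
    [/\ tychonoff_space Z, tychonoff_space M & @second_countable M] /\
    [/\ continuous f, set_surj [set: Z] [set: X] f,
        perfect_map p & set_surj [set: Z] [set: M] p].

(* [set_type A] carries the subspace topology; the library's [subspace A]
   keeps the whole carrier and isolates the points outside [A]. *)
Definition charming (X : topologicalType) : Prop :=
  exists Y : set X, lindelof_sigma (set_type Y) /\
    forall U : set X, open U -> Y `<=` U -> lindelof_sigma (set_type (~` U)).

Definition homeomorphism (S T : topologicalType) (f : S -> T) : Prop :=
  continuous f /\
  exists g : T -> S, [/\ continuous g, cancel f g & cancel g f].

Definition rectifiable (G : topologicalType) : Prop :=
  exists (phi : G * G -> G * G) (e : G),
    [/\ homeomorphism phi,
        fst \o phi = fst
      & forall x : G, phi (x, x) = (x, e)].

Definition countable_suslin_number (X : topologicalType) : Prop :=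
  forall F : set (set X),
    (forall U, F U -> open U /\ U !=set0) ->
    trivIset F id -> countable F.

(* Main.v *)
(* With p(x, .) inverse to q(x, .) := snd (phi (x, .)), the operation
   M(x, y, z) = p(x, q(y, z)) is a Maltsev operation: M(x, y, y) = x and
   M(x, x, y) = y; moreover M(b, a, .) is a homeomorphism sending a to b.
   As in Uspenskij's theorem, a disjoint family F of open sets that all meet a
   Lindelof Sigma subspace S is countable.  Otherwise pick x_U in the
   intersection of U and S for U in F, and close off to a countable subfamily A
   of F reflecting the countable network of S and, for every U in A, a countable
   closed cover of S whose members C satisfy M(x_U, C, C) <= U.  For B in F
   outside A, compactness gives y in the closure of {x_U : U in A} that lies in
   the same member as x_B of the cover attached to each U in A.  Then
   M(x_U, y, x_B) is in U for all U in A, and it is in B for some U in A since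
   M(y, y, x_B) = x_B.
   Let Y witness that G is charming.  If Y is dense, take S = Y.  Otherwise some
   closed neighbourhood of a point misses Y, hence is Lindelof Sigma, and since
   G is Lindelof countably many of its homeomorphic copies cover G. *)

Require Import Defs.
From HB Require Import structures.
From mathcomp Require Import finmap.
From mathcomp Require Import all_boot all_order all_algebra.
From mathcomp Require Import all_classical all_reals all_analysis.

Set Implicit Arguments.
Unset Strict Implicit.
Unset Printing Implicit Defensive.

Local Open Scope classical_set_scope.

(** * Closing off under countably many finitary operations; compactness by open covers *)

(** [A] consists of the values of finite trees with labels coding elements of [J]; there are only
    countably many such trees. *)
Lemma countable_closure (T : eqType) (J : countType) (g : J -> seq T -> T) :
  exists A : set T,
    countable A /\ forall j s, (forall x, x \in s -> A x) -> A (g j s).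
Proof.
case: (pselect (inhabited T)) => [[t0]|T0]; last first.
  exists set0; split=> // j s _; apply: T0; exact: (inhabits (g j s)).
pose fix ev (t : GenTree.tree J) : T :=
  match t with
  | GenTree.Leaf _ => t0
  | GenTree.Node n l =>
      if unpickle n is Some j then g j (map ev l) else t0
  end.
exists (range ev); split; first exact: (sub_countable (card_image_le _ _)).
move=> j s sA.
have [l <-] : exists l, map ev l = s.
  elim: s sA => [|x s IH] sA; first by exists [::].
  have [l <-] := IH (fun y ys => sA y (@mem_behead _ (x :: s) y ys)).
  have [t _ <-] := sA x (mem_head _ _).
  by exists (t :: l).
by exists (GenTree.Node (pickle j) l) => //=; rewrite pickleK.
Qed.

(* [compact_cover] is stated for pointed spaces only. *)
Lemma compact_cover_compact (X : topologicalType) (K : set X) :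
  compact K -> cover_compact K.
Proof.
have [->|/set0P [x0 _]] := eqVneq K set0.
  by move=> _ I D f _ _; exists fset0.
pose Xp : ptopologicalType := HB.pack X (isPointed.Build X x0).
by move=> cK; have : @compact Xp K by []; rewrite compact_cover.
Qed.

(** * Networks of Lindelof Sigma spaces and the Lindelof property *)

(* A network modulo a family of compact subsets of [S], as for Lindelof Sigma
   spaces; [K] need not contain [x]. *)
Definition sigma_network (X : topologicalType) (S : set X)
    (N : nat -> set X) : Prop :=
  forall x, S x -> exists K : set X, [/\ compact K, K `<=` S &
    forall U, open U -> K `<=` U -> exists2 n, N n x & N n `<=` U].

(** The network consists of the images under [f] of the [p]-preimages of basic open sets of [M]; the
    compact set for [x = f z] is the image of the fibre of [p] through [z]. *)
Lemma lindelof_sigma_network (X : topologicalType) (S : set X) :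
  lindelof_sigma (set_type S) -> exists N, sigma_network S N.
Proof.
move=> [Z [M [f [p [[_ _ [B /countable_injP [c cinj] [Bop Bnbhs]]]]]]]].
move=> [cf sf [cp clp kp] _].
have cvf : continuous (set_val \o f).
  move=> z; apply: continuous_comp; first exact: cf.
  exact: initial_continuous.
exists (fun n =>
  (set_val \o f) @` [set z | exists2 b, B b /\ c b = n & b (p z)]).
move=> x Sx; have [z _ fz] := sf (exist _ x (mem_set Sx)) I.
exists ((set_val \o f) @` (p @^-1` [set p z])); split.
- apply: continuous_compact; last exact: kp.
  exact: continuous_subspaceT.
- by move=> _ [w _ <-]; exact: set_valP.
- move=> U oU KU.
  have oO : open ((set_val \o f) @^-1` U).
    by apply: open_comp => // w _; exact: cvf.
  (* The points of [M] whose whole fibre is mapped into [U]; this set is open because [p] is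
     closed. *)
  have oV : open (~` (p @` (~` ((set_val \o f) @^-1` U)))).
    by apply: closed_openC; apply: clp; exact: open_closedC.
  have Vz : (~` (p @` (~` ((set_val \o f) @^-1` U)))) (p z).
    by move=> [w nUw pw]; apply: nUw; apply: KU; exists w.
  have [b [Bb bz] bV] := Bnbhs _ _ (open_nbhs_nbhs (conj oV Vz)).
  exists (c b).
    by exists z; [exists b | rewrite /= fz].
  move=> _ [w [b' [Bb' cb'] b'w] <-].
  have E : b' = b by apply: cinj => //; exact: mem_set.
  apply: contrapT => nU; apply: (bV (p w)); first by rewrite -E.
  by exists w.
Qed.

Lemma sigma_network_image (X Y : topologicalType) (h : X -> Y) (S : set X) N :
  continuous h -> sigma_network S N ->
  sigma_network (h @` S) (fun n => h @` N n).
Proof.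
move=> ch netS _ [x Sx <-]; have [K [cK KS KN]] := netS _ Sx.
exists (h @` K); split.
- by apply: continuous_compact => //; exact: continuous_subspaceT.
- exact: image_subset.
- move=> U oU KU; have [||n Nx NU] := KN (h @^-1` U).
  + by apply: open_comp => // w _; exact: ch.
  + by move=> y Ky; apply: KU; exists y.
  + by exists n; [exists x | move=> _ [y /NU Uy <-]].
Qed.

Lemma sigma_network_lindelof (X : topologicalType) (S : set X) N
    (P : set (set X)) :
  sigma_network S N -> (forall x, S x -> exists2 Q, nbhs x Q & P Q) ->
  exists D, [/\ countable D, D `<=` P & S `<=` \bigcup_(Q in D) Q].
Proof.
move=> netS covP.
(* For each [n], fix a finite subfamily of [P] covering [N n] if there is one. The union of these
   choices covers [S], since finitely many members of [P] cover the compact set of [x], hence also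
   some [N n] containing [x]. *)
have /choice [D DP] n : exists D : {fset (set X)}, {subset D <= P} /\
    ((exists2 D' : {fset (set X)}, {subset D' <= P} &
        N n `<=` cover [set` D'] id) -> N n `<=` cover [set` D] id).
  have [[D' D'P ND']|no] := pselect (exists2 D' : {fset (set X)},
    {subset D' <= P} & N n `<=` cover [set` D'] id); first by exists D'.
  by exists fset0; split.
exists (\bigcup_n [set` D n]); split.
- by apply: bigcup_countable => // n _; exact: countable_fset.
- by move=> Q [n _ /=] DO; apply: set_mem; exact: (DP n).1.
- move=> x Sx; have [K [cK KS KN]] := netS _ Sx.
  have [||D' D'P KD'] := compact_cover_compact cK (D := P) (f := interior).
  + by move=> Q _; exact: open_interior.
  + by move=> y /KS /covP [Q Oy PO]; exists Q.
  + have [||n Nx ND'] := KN (cover [set` D'] interior).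
    * by apply: bigcup_open => Q _; exact: open_interior.
    * exact: KD'.
    * have [|Q DO Ox] := (DP n).2 _ _ Nx; last by exists Q => //; exists n.
      exists D' => // y /ND' [Q DO Oy]; exists Q => //.
      exact: interior_subset.
Qed.

(** Countably many open members cover [Y]; the complement of their union is Lindelof Sigma, so
    countably many more cover the rest. *)
Lemma charming_lindelof (X : topologicalType) (P : set (set X)) :
  charming X -> (forall x, exists2 Q, open_nbhs x Q & P Q) ->
  exists D, [/\ countable D, D `<=` P & [set: X] `<=` \bigcup_(Q in D) Q].
Proof.
move=> [Y [/lindelof_sigma_network [N netY] coY]] covP.
pose P' := P `&` open.
have {}covP (x : X) : exists2 Q, nbhs x Q & P' Q.
  by have [Q [oQ Qx] PQ] := covP x; exists Q => //; exact: open_nbhs_nbhs.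
have [D [cD DP YD]] := sigma_network_lindelof netY (fun x _ => covP x).
have [|N' netY'] := lindelof_sigma_network (coY (\bigcup_(Q in D) Q) _ YD).
  by apply: bigcup_open => Q /DP [].
have [D' [cD' DP' YD']] := sigma_network_lindelof netY' (fun x _ => covP x).
exists (D `|` D'); split.
- by rewrite -bigcup2E; apply: bigcup_countable => // -[|[|n]] _ //=.
- by move=> Q [/DP|/DP'] [].
- move=> x _; rewrite bigcup_setU.
  by have [?|/YD' ?] := pselect ((\bigcup_(Q in D) Q) x); [left|right].
Qed.

(** * Regularity and joint continuity *)

Lemma completely_regular_is_regular (X : topologicalType) :
  completely_regular_space X -> regular_space X.
Proof.
move=> crX x A /nbhs_interior Ax.
have [||uT [E [entE sep coarse]]] := crX x (~` A°).
- exact/open_closedC/open_interior.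
- by apply; exact: nbhs_singleton.
pose UT := Uniform.Pack uT.
exists (xsection (@split_ent UT E) x).
  by apply: coarse; rewrite -nbhs_entourageE; exists (@split_ent UT E).
move=> z Vz; apply: interior_subset; apply: contrapT => nAz.
have /xsectionP Exz : xsection E x z.
  (* The closure in [X] lies in the closure for the coarser uniform topology, which in turn lies in
     the section of [E]. *)
  by apply: (@ent_closure UT) => // B /coarse; exact: Vz.
by rewrite -[False]/(set0 (x, z)) -sep.
Qed.

Lemma continuous_pair (W X Y : topologicalType) (f : W -> X) (g : W -> Y) :
  continuous f -> continuous g -> continuous (fun w => (f w, g w)).
Proof. by move=> cf cg w; apply: cvg_pair; [exact: cf | exact: cg]. Qed.

Lemma continuous_apply3 (W X Y : topologicalType) (M : X -> X -> X -> Y)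
    (f g h : W -> X) : continuous (fun p : X * X * X => M p.1.1 p.1.2 p.2) ->
  continuous f -> continuous g -> continuous h ->
  continuous (fun w => M (f w) (g w) (h w)).
Proof.
move=> cM cf cg ch w.
apply: (@continuous_comp _ _ _ (fun w => (f w, g w, h w))
  (fun p : X * X * X => M p.1.1 p.1.2 p.2)); last exact: cM.
by apply: continuous_pair => //; exact: continuous_pair.
Qed.

(** * Disjoint families in the presence of a Maltsev operation *)

Section Maltsev.
Variables (X : topologicalType) (M : X -> X -> X -> X).
Hypothesis regX : regular_space X.
Hypothesis MC : continuous (fun p : X * X * X => M p.1.1 p.1.2 p.2).
Hypothesis Mxyy : forall x y, M x y y = x.
Hypothesis Mxxy : forall x y, M x x y = y.

(** Since [M x y y = x] lies in [U], continuity and regularity give each [y] a closed neighbourhood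
    [C] with [M x C C] inside [U]; countably many of these cover [S]. *)
Lemma maltsev_closed_cover (S : set X) N (U : set X) x :
  sigma_network S N -> open U -> U x ->
  exists C : nat -> set X, [/\ forall n, closed (C n),
    S `<=` \bigcup_n C n & forall n y z, C n y -> C n z -> U (M x y z)].
Proof.
move=> netS oU Ux.
pose P := [set C | closed C /\ forall y z, C y -> C z -> U (M x y z)].
have [|D [/countable_injP [c cinj] DP SD]] :=
    sigma_network_lindelof (P := P) netS.
  move=> y _.
  have : nbhs (y, y) [set q : X * X | U (M x q.1 q.2)].
    have cM : continuous (fun q : X * X => M x q.1 q.2).
      apply: (continuous_apply3 MC) => q.
      - exact: cvg_cst.
      - exact: cvg_fst.
      - exact: cvg_snd.
    by apply: cM; apply: open_nbhs_nbhs; split => //=; rewrite Mxyy.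
  case=> -[A B] [/= yA yB] AB.
  have [V yV VAB] := regX (filterI yA yB).
  exists (closure V).
    by apply: filterS yV; exact: subset_closure.
  split; first exact: closed_closure.
  by move=> a b /VAB [Aa _] /VAB [_ Bb]; apply: (AB (a, b)).
have /choice [C CP] n : exists C, [/\ closed C,
    forall y z, C y -> C z -> U (M x y z) &
    forall Q, D Q -> c Q = n -> Q `<=` C].
  have [[Q [DO cO]]|no] := pselect (exists Q, D Q /\ c Q = n).
    have [clO OU] := DP _ DO; exists Q; split=> // Q' DO' cO'.
    by rewrite (cinj Q' Q) ?mem_set// cO' cO.
  exists set0; split=> //; first exact: closed0.
  by move=> Q DO cO; case: no; exists Q.
exists C; split.
- by move=> n; case: (CP n).
- move=> y /SD [Q DO Oy]; exists (c Q) => //.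
  by case: (CP (c Q)) => _ _ /(_ Q DO erefl); exact.
- by move=> n; case: (CP n).
Qed.

Lemma countable_disjoint_family_meeting (S : set X) N (F : set (set X)) :
  sigma_network S N -> (forall U, F U -> open U /\ U `&` S !=set0) ->
  trivIset F id -> countable F.
Proof.
move=> netS FS trF.
have [->|/set0P [U0 /FS [_ [p0 _]]]] := eqVneq F set0; first exact: countable0.
have /choice [x xP] (U : set X) : exists x, F U -> U x /\ S x.
  have [/FS [_ [x Ux]]|] := pselect (F U); first by exists x.
  by exists p0.
have /choice [C CP] (U : set X) : exists C : nat -> set X, F U ->
    [/\ forall n, closed (C n), S `<=` \bigcup_n C n &
    forall n y z, C n y -> C n z -> U (M (x U) y z)].
  have [FU|] := pselect (F U); last by exists (fun=> set0).
  have [C CU] := maltsev_closed_cover netS (FS _ FU).1 (xP _ FU).1.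
  by exists C.
pose E (j : nat * seq nat) (s : seq (set X)) : set X := [set z | N j.1 z /\
  forall q, q \in zip s j.2 -> C q.1 q.2 z].
(* [g] returns a member of [F] whose chosen point satisfies the finitary condition [E], whenever one
   exists. Closing off under [g] may add junk such as [set0], so only [A] intersected with [F] is
   used below. *)
have /choice [g gP] (js : (nat * seq nat) * seq (set X)) : exists V,
    (exists2 U, F U & E js.1 js.2 (x U)) -> F V /\ E js.1 js.2 (x V).
  have [[V FV EV]|no] := pselect (exists2 U, F U & E js.1 js.2 (x U)).
    by exists V.
  by exists set0.
have [A [cA Acl]] := countable_closure (fun j s => g (j, s)).
apply: (sub_countable _ cA); apply: subset_card_le => B FB.
apply: contrapT => nAB.
have [xB SxB] := xP _ FB.
have /choice [n nP] (U : set X) : exists n, F U -> C U n (x B).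
  have [FU|] := pselect (F U); last by exists 0.
  by have [_ /(_ _ SxB) [n _ Cn] _] := CP _ FU; exists n.
have [K [cK KS KN]] := netS _ SxB.
have [y [Ky Ty Cy]] : exists y, [/\ K y, closure (x @` (A `&` F)) y &
    forall U, A U -> F U -> C U (n U) y].
  (* Otherwise finitely many complements of [C U (n U)] cover the part of [K] in the closure. With
     the complement of the closure they form an open [Q] containing [K], hence some [N m] containing
     [x B]. *)
  apply: contrapT => no.
  have [||D DAF KD] := compact_cover_compact
    (compact_closedI cK (@closed_closure _ (x @` (A `&` F))))
    (D := A `&` F) (f := fun U => ~` C U (n U)).
  - by move=> U [_ FU]; apply: closed_openC; case: (CP _ FU).
  - move=> y [Ky Ty]; apply: contrapT => nc; apply: no; exists y; split=> //.
    move=> U AU FU; apply: contrapT => nCU; apply: nc.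
    by exists U.
  have DA U : U \in D -> (A `&` F) U by move=> /DAF; exact: set_mem.
  pose Q := ~` closure (x @` (A `&` F)) `|`
    cover [set` D] (fun U => ~` C U (n U)).
  have [||m Nm NO] := KN Q.
  + apply: openU; first exact/closed_openC/closed_closure.
    apply: bigcup_open => U /DA [_ FU].
    by apply: closed_openC; case: (CP _ FU).
  + move=> y Ky; have [Ty|] := pselect (closure (x @` (A `&` F)) y).
      by right; apply: KD.
    by left.
  pose j := (m, [seq n U | U <- D]).
  have zipE q : q \in zip (D : seq (set X)) j.2 -> q.1 \in D /\ q.2 = n q.1.
    by rewrite /= -[X in zip X _]map_id zip_map => /mapP [U UD ->].
  (* As [B] itself satisfies this condition, [g] yields a member of [A] and [F] whose point is in
     [N m] and in every [C U (n U)] for [U] in [D], so outside [Q]: a contradiction. *)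
  have [|FV [NV EV]] := gP (j, D : seq (set X)).
    exists B => //; split=> // q /zipE [/DA [_ Fq] ->].
    exact: nP.
  have AV : A (g (j, D : seq (set X))) by apply: Acl => U /DA [].
  case: (NO _ NV) => [|[U UD]].
    by apply; apply: subset_closure; exists (g (j, D : seq (set X))).
  apply; apply: (EV (U, n U)).
  rewrite /= -[X in zip X _]map_id zip_map; apply/mapP; exists U => //.
have : nbhs y [set a | B (M a y (x B))].
  have cM : continuous (fun a => M a y (x B)).
    by apply: (continuous_apply3 MC) => a; [exact: cvg_id | exact: cvg_cst..].
  apply: cM; apply: open_nbhs_nbhs; rewrite Mxxy; split=> //.
  by case: (FS _ FB).
move=> /Ty [_ [[U [AU FU] <-] BM]].
suff UB : U = B by apply: nAB; rewrite -UB.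
apply: trF => //; exists (M (x U) y (x B)); split=> //.
have [_ _ CU] := CP _ FU; apply: (CU (n U)); first exact: Cy.
exact: nP.
Qed.

End Maltsev.

(** * From rectifiable spaces to the theorem *)

(** Both [phi] and its inverse [psi] preserve first coordinates, so the identities follow by
    cancellation. The last one makes [M x y] and [M y x] mutually inverse. *)
Lemma rectifiable_maltsev (G : topologicalType) : rectifiable G ->
  exists M : G -> G -> G -> G,
    [/\ continuous (fun p : G * G * G => M p.1.1 p.1.2 p.2),
        forall x y, M x y y = x, forall x y, M x x y = y
      & forall x y z, M x y (M y x z) = z].
Proof.
move=> [phi [e [[cphi [psi [cpsi phiK psiK]]] phi1 phixx]]].
have phiE x y : phi (x, y) = (x, (phi (x, y)).2).
  by rewrite [LHS]surjective_pairing -[(phi _).1]/((fst \o phi) _) phi1.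
have psiE x y : psi (x, y) = (x, (psi (x, y)).2).
  rewrite [LHS]surjective_pairing; congr pair.
  rewrite -[RHS]/(x, y).1 -[in RHS](psiK (x, y)).
  by rewrite -[in RHS]/((fst \o phi) _) phi1.
exists (fun x y z => (psi (x, (phi (y, z)).2)).2); split.
- have c1 : continuous (fun p : G * G * G => p.1.1).
    by move=> p; apply: (@continuous_comp _ _ _ fst fst); exact: cvg_fst.
  have c2 : continuous (fun p : G * G * G => p.1.2).
    move=> p; apply: (@continuous_comp _ _ _ fst snd); first exact: cvg_fst.
    exact: cvg_snd.
  have c3 : continuous (fun p : G * G * G => p.2) by move=> p; exact: cvg_snd.
  have cq : continuous (fun p : G * G * G => (phi (p.1.2, p.2)).2).
    move=> p; apply: (@continuous_comp _ _ _ (fun p => phi (p.1.2, p.2)) snd);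
      last exact: cvg_snd.
    apply: (@continuous_comp _ _ _ (fun p : G * G * G => (p.1.2, p.2)) phi);
      last exact: cphi.
    exact: continuous_pair.
  move=> p; apply: (@continuous_comp _ _ _
    (fun p => psi (p.1.1, (phi (p.1.2, p.2)).2)) snd); last exact: cvg_snd.
  apply: (@continuous_comp _ _ _
    (fun p => (p.1.1, (phi (p.1.2, p.2)).2)) psi); last exact: cpsi.
  exact: continuous_pair.
- by move=> x y; rewrite phixx /= -phixx phiK.
- by move=> x y; rewrite -phiE phiK.
- by move=> x y z; rewrite -psiE psiK /= -phiE phiK.
Qed.

Theorem theorem6p5 (G : topologicalType) (tychonoffG : tychonoff_space G)
    (rectifiableG : rectifiable G) (charmingG : charming G) :
  countable_suslin_number G.
Proof.
have regG := completely_regular_is_regular tychonoffG.2.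
have [M [MC Mxyy Mxxy Mxyx]] := rectifiable_maltsev rectifiableG.
have [Y [/lindelof_sigma_network [NY netY] coY]] := charmingG.
move=> F Fop trF.
have [dY|/existsNP [a nYa]] := pselect (forall a, closure Y a).
  apply: (countable_disjoint_family_meeting regG MC Mxyy Mxxy netY) => // U FU.
  have [oU [a Ua]] := Fop _ FU; split=> //.
  by rewrite setIC; apply: (dY a); exact: open_nbhs_nbhs.
have [V aV VY] : exists2 V, nbhs a V & closure V `<=` ~` closure Y.
  apply: (regG a); apply: open_nbhs_nbhs; split => //.
  exact/closed_openC/closed_closure.
have [NV netV] : exists N, sigma_network (closure V) N.
  apply: lindelof_sigma_network; rewrite -[closure V]setCK; apply: coY.
    exact/closed_openC/closed_closure.
  by move=> y Yy /VY; apply; exact: subset_closure.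
have cM b c : continuous (M b c).
  by apply: (continuous_apply3 MC) => z; [exact: cvg_cst..|exact: cvg_id].
(* The image of [V] under [M b a] contains the preimage of [V] under the inverse map [M a b], which
   sends [b] to [a]. *)
have nbhsM b : nbhs b (M b a @` V).
  have : nbhs b (M a b @^-1` V) by apply: cM; rewrite Mxyy.
  by apply: filterS => z Vz; exists (M a b z).
have [|D [cD DP GD]] := charming_lindelof (P := range (fun b => (M b a @` V)°))
  charmingG.
  move=> b; exists (M b a @` V)°; last by exists b.
  by split; [exact: open_interior | exact: nbhsM].
(* Each member of [F] meets some [Q] in [D], and those meeting a given [Q] all meet a copy of
   [closure V], which has a network. *)
apply: (@sub_countable _ _ _
  (\bigcup_(Q in D) [set U | F U /\ U `&` Q !=set0])).
  apply: subset_card_le => U FU; have [_ [z Uz]] := Fop _ FU.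
  by have [Q DQ Qz] := GD z I; exists Q => //; split=> //; exists z.
apply: bigcup_countable => // Q /DP [b _ <-].
apply: (countable_disjoint_family_meeting regG MC Mxyy Mxxy
  (sigma_network_image (cM b a) netV)).
  move=> U [/Fop [oU _] [z [Uz /interior_subset [v Vv Ez]]]]; split=> //.
  by exists z; split=> //; exists v => //; exact: subset_closure.
by apply: sub_trivIset trF => U [].
Qed.
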